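(* Let $\mathcal R_J$ be the Jacobi realization determined by real $b_0,\dots,b_{N-1}$ and positive $a_1,\dots,a_{N-1}$ (with $P_s(\eta)>0$ for $s=0,\dots,N$). For $x,y\in[-1,1]$ write $$K_s(x,y):=K_{s,\mathcal R_J}(\lambda(x),\lambda(y)),\qquad \lambda(u):=\frac{L+\mu}{2}-\frac{\Delta}{2}u.$$ Then $$K_s(x,y)=-\frac{2}{\Delta P_N(\eta)}\,Q_{N-s-1}^{(s+1)}(x)\,P_s(y),\qquad s=0,\ldots,N-1.$$ Consequently $$A_N(J)=\frac{2}{\Delta|P_N(\eta)|}\sup_{x,y\in[-1,1]}\Bigl(\sum_{s=0}^{N-1}\bigl|Q_{N-s-1}^{(s+1)}(x)P_s(y)\bigr|^2\Bigr)^{1/2}.$$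
   Context: Fix $0<\mu<L$, $N\ge1$, $\Delta=L-\mu$, $\eta=\frac{L+\mu}{L-\mu}$. Put $P_{-1}=0$, $P_0=1$, $a_0=0$ and $P_{s+1}(z)=(z-b_s)P_s(z)-a_s^2P_{s-1}(z)$ for $s=0,\dots,N-1$. Let $J$ be the $N\times N$ Jacobi (symmetric tridiagonal) matrix with diagonal entries $b_0,\dots,b_{N-1}$ and off-diagonal entries $a_1,\dots,a_{N-1}$, sites indexed $0,\dots,N-1$. For the right tail block $J_{s+1:N-1}$ (principal submatrix on sites $s+1,\dots,N-1$) set $Q_{N-s-1}^{(s+1)}(z)=\det(zI-J_{s+1:N-1})$, with $Q_0^{(N)}:=1$. The Jacobi realization $\mathcal R_J$ is the two-term method $$x_1=\frac1{P_1(\eta)}\Bigl[(\eta-b_0)x_0-\frac{2}{\Delta}\nabla f(x_0)\Bigr],$$ $$x_{s+1}=\frac{P_s(\eta)}{P_{s+1}(\eta)}\Bigl[(\eta-b_s)x_s-\frac{2}{\Delta}\nabla f(x_s)\Bigr]-a_s^2\frac{P_{s-1}(\eta)}{P_{s+1}(\eta)}x_{s-1},\quad 1\le s\le N-1.$$ First-variation kernel and gain: with $$\gamma_s=\frac{2P_s(\eta)}{\Delta P_{s+1}(\eta)},\qquad C_s(\lambda)=\begin{pmatrix}\frac{P_s(\eta)}{P_{s+1}(\eta)}(\eta-b_s)-\gamma_s\lambda & -a_s^2\frac{P_{s-1}(\eta)}{P_{s+1}(\eta)}\\ 1&0\end{pmatrix},\qquad e_1=\begin{pmatrix}1\\0\end{pmatrix},$$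 (for $s=0$ the upper-right entry is $0$), the kernel is $$K_{s,\mathcal R_J}(\lambda,\nu)=-\,\gamma_s\; e_1^\top C_{N-1}(\lambda)\cdots C_{s+1}(\lambda)\,e_1\; e_1^\top C_{s-1}(\nu)\cdots C_0(\nu)\,e_1,\qquad 0\le s\le N-1,$$ with empty products equal to the identity, and $$A_N(J)=\sup_{\lambda,\nu\in[\mu,L]}\Bigl(\sum_{s=0}^{N-1}|K_{s,\mathcal R_J}(\lambda,\nu)|^2\Bigr)^{1/2}.$$ *)

(* Defs.v *)
From HB Require Import structures.
From mathcomp Require Import all_boot all_order all_algebra.
From mathcomp Require Import classical_sets reals.

Set Implicit Arguments.
Unset Strict Implicit.
Unset Printing Implicit Defensive.
Import Order.TTheory GRing.Theory Num.Theory.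
Local Open Scope ring_scope.

Definition gap (R : realType) (mu L : R) : R := L - mu.

Definition eta_param (R : realType) (mu L : R) : R := (L + mu) / (L - mu).

Definition spectral_param (R : realType) (mu L u : R) : R :=
  (L + mu) / 2 - gap mu L / 2 * u.

(* The Jacobi parameters are sequences [a], [b] : nat -> R, of which only
   a_0, ..., a_(N-1) and b_0, ..., b_(N-1) are used.  [jacobi_pair a b s] is
   the pair (P_(s-1), P_s), starting from (P_(-1), P_0) = (0, 1). *)
Fixpoint jacobi_pair (R : realType) (a b : nat -> R) (s : nat) :
    {poly R} * {poly R} :=
  if s is s'.+1 then
    let: (q, p) := jacobi_pair a b s' in
    (p, ('X - (b s')%:P) * p - (a s' ^+ 2)%:P * q)
  else (0, 1).

Definition jacobiP (R : realType) (a b : nat -> R) (s : nat) : {poly R} :=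
  (jacobi_pair a b s).2.

(* P_(s-1), with P_(-1) = 0. *)
Definition jacobiP_pred (R : realType) (a b : nat -> R) (s : nat) : {poly R} :=
  (jacobi_pair a b s).1.

(* The entry a_i couples the sites i-1 and i. *)
Definition jacobi_mx (R : realType) (N : nat) (a b : nat -> R) : 'M[R]_N :=
  \matrix_(i < N, j < N)
    if i == j then b i
    else if j == i.+1 :> nat then a j
    else if i == j.+1 :> nat then a i
    else 0.

Lemma tail_ord_subproof (N k : nat) (i : 'I_(N - k)) : (k + i < N)%N.
Proof. by rewrite -ltn_subRL. Qed.

Definition tail_ord (N k : nat) (i : 'I_(N - k)) : 'I_N :=
  Ordinal (tail_ord_subproof i).

(* Principal submatrix on the sites k, ..., N-1 (empty for k = N). *)
Definition tail_block (R : realType) (N k : nat) (J : 'M[R]_N) : 'M[R]_(N - k) :=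
  mxsub (@tail_ord N k) (@tail_ord N k) J.

(* The polynomial Q_(N-k)^(k); for k = N it is the empty determinant 1. *)
Definition jacobiQ (R : realType) (N : nat) (a b : nat -> R) (k : nat) :
    {poly R} :=
  char_poly (tail_block k (jacobi_mx N a b)).

(* Coefficients of a method
   x_(s+1) = cur_s x_s - step_s grad f(x_s) - prev_s x_(s-1). *)
Record two_term_method (R : realType) := TwoTermMethod {
  cur_coef : nat -> R;
  step_coef : nat -> R;
  prev_coef : nat -> R }.

(* [x] is the sequence of the first N iterates of [M] for the gradient oracle
   [g].  For s = 0 the term x_(s-1) is read as x_0; it is irrelevant for the
   Jacobi realization, whose [prev_coef] vanishes at 0. *)
Definition two_term_run (R : realType) (V : lmodType R)
    (M : two_term_method R) (g : V -> V) (N : nat) (x : nat -> V) : Prop :=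
  forall s, (s < N)%N ->
    x s.+1 = cur_coef M s *: x s - step_coef M s *: g (x s)
             - prev_coef M s *: x s.-1.

Definition jacobi_realization (R : realType) (mu L : R) (a b : nat -> R) :
    two_term_method R :=
  let P s := (jacobiP a b s).[eta_param mu L] in
  let Ppred s := (jacobiP_pred a b s).[eta_param mu L] in
  {| cur_coef := fun s => P s / P s.+1 * (eta_param mu L - b s);
     step_coef := fun s => 2 * P s / (gap mu L * P s.+1);
     prev_coef := fun s => a s ^+ 2 * (Ppred s / P s.+1) |}.

Definition companion (R : realType) (M : two_term_method R) (s : nat) (l : R) :
    'M[R]_2 :=
  \matrix_(i < 2, j < 2)
    if i == 0 then
      if j == 0 then cur_coef M s - step_coef M s * l else - prev_coef M s
    else
      if j == 0 then 1 else 0.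

(* C_(n-1)(l) ... C_m(l): the factors are in decreasing order of the index. *)
Definition companion_prod (R : realType) (M : two_term_method R) (m n : nat)
    (l : R) : 'M[R]_2 :=
  \prod_(i <- rev (index_iota m n)) companion M i l.

Definition e1 (R : realType) : 'cV[R]_2 := delta_mx 0 0.

Definition variation_kernel (R : realType) (N : nat) (M : two_term_method R)
    (s : nat) (l nu : R) : R :=
  - step_coef M s
  * ((e1 R)^T *m companion_prod M s.+1 N l *m e1 R) 0 0
  * ((e1 R)^T *m companion_prod M 0 s nu *m e1 R) 0 0.

(* The kernels are polynomials in (l, nu), so the set below is bounded. *)
Definition gain (R : realType) (mu L : R) (N : nat) (M : two_term_method R) :
    R :=
  sup [set t | exists l nu : R, [/\ mu <= l <= L, mu <= nu <= L &
    t = Num.sqrt (\sum_(s < N) `|variation_kernel N M s l nu| ^+ 2)]]%classic.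

(* Main.v *)
(* With x = eta - 2 lambda(x) / Delta, the companion matrices obey the three-term
   recurrences up to the normalization by P_s(eta): the products applied to e_1
   from the right propagate P_s(y) / P_s(eta), while e_1^T applied from the left
   propagates P_m(eta) / P_N(eta) Q^(m)(x), because expanding the tail
   determinant along its first row gives
   Q^(m) = (x - b_m) Q^(m+1) - a_(m+1)^2 Q^(m+2).
   Multiplying the two corners, all P_s(eta) except P_N(eta) cancel. *)
Require Import Defs.
From HB Require Import structures.
From mathcomp Require Import all_boot all_order all_algebra.
From mathcomp Require Import ring lra.
From mathcomp Require Import boolp classical_sets reals.

Set Implicit Arguments.
Unset Strict Implicit.
Unset Printing Implicit Defensive.
Import Order.TTheory GRing.Theory Num.Theory.
Local Open Scope ring_scope.

(** * Suprema under positive scaling *)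

Lemma has_sup_pscale (R : realType) (S : set R) (c : R) : 0 < c ->
  has_sup S -> has_sup [set c * x | x in S]%classic.
Proof.
move=> c0 [[x Sx] [u uS]]; split; first by exists (c * x), x.
by exists (c * u) => _ [y Sy <-]; rewrite ler_pM2l ?uS.
Qed.

(** If [S] has no supremum, neither has its image, and both sides are the default value 0. Otherwise
    one inequality suffices, applied to [c] and to [c^-1]. *)
Lemma sup_pscale (R : realType) (S : set R) (c : R) : 0 < c ->
  sup [set c * x | x in S]%classic = c * sup S.
Proof.
move=> c0; have cS := has_sup_pscale c0.
have le_sup T d : 0 < d -> has_sup T ->
    sup [set d * x | x in T]%classic <= d * sup T.
  move=> d0 [[x Tx] ubT]; apply: ge_sup; first by exists (d * x), x.
  by move=> _ [y Ty <-]; rewrite ler_pM2l // ub_le_sup.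
have SE : [set c^-1 * x | x in [set c * x | x in S]]%classic = S.
  apply/seteqP; split=> [_ [_ [x Sx <-] <-]|x Sx]; first by rewrite mulKf ?gt_eqF.
  by exists (c * x); [exists x | rewrite mulKf ?gt_eqF].
have [hS|nS] := pselect (has_sup S); last first.
  rewrite !sup_out ?mulr0 // => hcS; apply: nS; rewrite -SE.
  by apply: has_sup_pscale; rewrite ?invr_gt0.
(* The reverse inequality is [le_sup] for the scaled set and the factor [c^-1], since [SE] recovers
   [S]. *)
apply/le_anti; rewrite le_sup //= -ler_pdivlMl // -{1}SE.
by apply: le_sup; [rewrite invr_gt0 | exact: cS].
Qed.

(** * Characteristic polynomials of the tail blocks *)

(** Two cofactors survive along row 0. The minor of the second keeps column 0 of [A] without its top
    entry, so expanding it along that column leaves a single term. *)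
Lemma det_first_tridiag (R : comNzRingType) (n : nat) (A : 'M[R]_n.+2) :
  (forall j : 'I_n.+2, (1 < j)%N -> A 0 j = 0) ->
  (forall i : 'I_n.+2, (1 < i)%N -> A i 0 = 0) ->
  \det A = A 0 0 * \det (row' 0 (col' 0 A))
    - A 0 (lift 0 0) * A (lift 0 0) 0
      * \det (row' 0 (col' 0 (row' 0 (col' 0 A)))).
Proof.
move=> A0j Ai0.
have l10 : @lift n.+2 (lift 0 0) (0 : 'I_n.+1) = 0 by apply: val_inj.
rewrite (expand_det_row A 0) 2!big_ord_recl big1 ?addr0; last first.
  by move=> j _; rewrite A0j ?mul0r // lift0.
rewrite /cofactor /= expr0 mul1r; congr (_ + _).
rewrite expr1 mulN1r mulrN -mulrA; congr (- (_ * _)).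
rewrite (expand_det_col _ 0) big_ord_recl big1 ?addr0; last first.
  move=> i _; by rewrite !mxE l10 Ai0 ?mul0r // !lift0.
rewrite /cofactor expr0 mul1r !mxE l10.
congr (_ * \det _); apply/matrixP => i j; rewrite !mxE.
by congr (A _ _); apply: val_inj.
Qed.

Lemma char_poly_mx_jacobi_shift (R : realType) (n : nat) (a b : nat -> R) :
  row' 0 (col' 0 (char_poly_mx (jacobi_mx n.+1 a b)))
  = char_poly_mx (jacobi_mx n (a \o succn) (b \o succn)).
Proof. by apply/matrixP => i j; rewrite !mxE !lift0 !eqSS (inj_eq lift_inj). Qed.

Lemma char_poly_jacobi_rec (R : realType) (n : nat) (a b : nat -> R) :
  char_poly (jacobi_mx n.+2 a b)
  = ('X - (b 0)%:P) * char_poly (jacobi_mx n.+1 (a \o succn) (b \o succn))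
    - (a 1 ^+ 2)%:P
      * char_poly (jacobi_mx n (a \o succn \o succn) (b \o succn \o succn)).
Proof.
rewrite /char_poly det_first_tridiag.
- rewrite !char_poly_mx_jacobi_shift !mxE /= !mulr1n !mulr0n !sub0r.
  by rewrite mulrNN -polyCM expr2.
- by move=> [[|[|j]] lt_j] //= _; rewrite !mxE /= mulr0n polyC0 subr0.
- by move=> [[|[|i]] lt_i] //= _; rewrite !mxE /= mulr0n polyC0 subr0.
Qed.

Lemma tail_jacobi (R : realType) (N k : nat) (a b : nat -> R) :
  tail_block k (jacobi_mx N a b)
  = jacobi_mx (N - k) (a \o addn k) (b \o addn k).
Proof.
apply/matrixP => i j; rewrite !mxE /= -!addnS !eqn_add2l.
by rewrite -(inj_eq val_inj) /= eqn_add2l.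
Qed.

(** A free size [n] in place of [N - k] allows the successor forms that the determinant recurrence
    requires of the matrix dimension. *)
Lemma jacobiQE (R : realType) (N k n : nat) (a b : nat -> R) :
  N = (k + n)%N ->
  jacobiQ N a b k = char_poly (jacobi_mx n (a \o addn k) (b \o addn k)).
Proof. by move=> ->; rewrite /jacobiQ tail_jacobi addKn. Qed.

Lemma jacobiQ_full (R : realType) (N : nat) (a b : nat -> R) :
  jacobiQ N a b N = 1.
Proof. by rewrite (jacobiQE _ _ (esym (addn0 N))) /char_poly det_mx00. Qed.

Lemma jacobiQ_last (R : realType) (N : nat) (a b : nat -> R) :
  jacobiQ N.+1 a b N = 'X - (b N)%:P.
Proof.
rewrite (jacobiQE _ _ (esym (addn1 N))) /char_poly det_mx11 !mxE /=.
by rewrite mulr1n addn0.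
Qed.

(** The bound on [k] leaves at least two sites in the block; for [k.+2 = N] the last factor is the
    empty determinant 1. *)
Lemma jacobiQ_rec (R : realType) (N k : nat) (a b : nat -> R) : (k.+1 < N)%N ->
  jacobiQ N a b k = ('X - (b k)%:P) * jacobiQ N a b k.+1
    - (a k.+1 ^+ 2)%:P * jacobiQ N a b k.+2.
Proof.
move=> lt_kN; pose n := (N - k.+2)%N.
have N2 : N = (k.+2 + n)%N by rewrite subnKC.
have N1 : N = (k.+1 + n.+1)%N by rewrite N2 addSnnS.
have N0 : N = (k + n.+2)%N by rewrite N1 addSnnS.
rewrite (jacobiQE _ _ N0) (jacobiQE _ _ N1) (jacobiQE _ _ N2).
rewrite char_poly_jacobi_rec /= addn0 addn1.
have E m (f : nat -> R) : (f \o addn m) \o succn = f \o addn m.+1.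
  by apply/funext => i /=; rewrite addnS addSn.
by rewrite !E.
Qed.

(** * Values of the polynomials P and factorization of companion products *)

Lemma jacobiP_predS (R : realType) (a b : nat -> R) (s : nat) :
  jacobiP_pred a b s.+1 = jacobiP a b s.
Proof. by rewrite /jacobiP_pred /jacobiP /=; case: jacobi_pair. Qed.

Lemma horner_jacobiPS (R : realType) (a b : nat -> R) (s : nat) (u : R) :
  (jacobiP a b s.+1).[u]
  = (u - b s) * (jacobiP a b s).[u] - a s ^+ 2 * (jacobiP_pred a b s).[u].
Proof.
rewrite /jacobiP_pred /jacobiP /=; case: jacobi_pair => q p /=.
by rewrite hornerD hornerN !hornerM hornerXsubC !hornerC.
Qed.

Lemma companion_prod_nil (R : realType) (M : two_term_method R) (n : nat)
    (l : R) : companion_prod M n n l = 1%:M.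
Proof. by rewrite /companion_prod /index_iota subnn big_nil. Qed.

Lemma companion_prodSr (R : realType) (M : two_term_method R) (m n : nat)
    (l : R) : (m <= n)%N ->
  companion_prod M m n.+1 l = companion M n l *m companion_prod M m n l.
Proof.
move=> le_mn; rewrite /companion_prod /index_iota subSn // -[(n - m).+1]addn1 iotaD cats1.
by rewrite rev_rcons big_cons subnKC.
Qed.

(** Peels off the factor of smallest index, for the induction on the tail; [companion_prodSr] peels
    off the one of largest index, for the induction on the head. *)
Lemma companion_prodSl (R : realType) (M : two_term_method R) (m n : nat)
    (l : R) : (m < n)%N ->
  companion_prod M m n l = companion_prod M m.+1 n l *m companion M m l.
Proof.
move=> lt_mn; rewrite /companion_prod /index_iota.
rewrite -[(n - m)%N]prednK ?subn_gt0 // -subnS /= rev_cons -cats1 big_cat.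
by rewrite big_seq1.
Qed.

Lemma mulmx2E (R : pzSemiRingType) (A B : 'M[R]_2) (i j : 'I_2) :
  (A *m B) i j = A i 0 * B 0 j + A i 1 * B 1 j.
Proof.
rewrite !mxE !big_ord_recl big_ord0 addr0.
by rewrite (_ : lift 0 0 = 1) //; exact: val_inj.
Qed.

Lemma companion_upper (R : realType) (M : two_term_method R) (s : nat) (l : R) :
  companion M s l 0 1 = - prev_coef M s.
Proof. by rewrite mxE. Qed.

Lemma companion_lower (R : realType) (M : two_term_method R) (s : nat) (l : R) :
  (companion M s l 1 0 = 1) * (companion M s l 1 1 = 0).
Proof. by rewrite !mxE. Qed.

Lemma e1_corner (R : realType) (A : 'M[R]_2) :
  ((e1 R)^T *m A *m e1 R) 0 0 = A 0 0.
Proof.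
by rewrite /e1 trmx_delta -rowE -colE !mxE.
Qed.

(** * Corners of the companion products and the kernel formula *)

Section JacobiKernel.
Variables (R : realType) (mu L : R) (N : nat) (a b : nat -> R).
Hypotheses (hL : mu < L) (ha0 : a 0%N = 0).
Let eta := eta_param mu L.
Hypothesis hP : forall s : nat, (s <= N)%N -> 0 < (jacobiP a b s).[eta].
Let M := jacobi_realization mu L a b.

Lemma gap_neq0 : gap mu L != 0.
Proof. by rewrite subr_eq0 gt_eqF. Qed.

Lemma companion_corner (s : nat) (x : R) : (s < N)%N ->
  companion M s (spectral_param mu L x) 0 0
  = (jacobiP a b s).[eta] / (jacobiP a b s.+1).[eta] * (x - b s).
Proof.
move=> lt_sN; have := gt_eqF (hP lt_sN); have := gap_neq0.
have etaE : eta = (L + mu) / gap mu L by [].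
rewrite mxE /= -/eta /spectral_param => g0 /negbT p0.
(* Only the free-standing [eta] is unfolded, so that it cancels against the spectral parameter; the
   values of P at [eta] stay atoms for [field]. *)
by rewrite [X in _ * (X - _) - _]etaE; field; rewrite p0 g0.
Qed.

Lemma prev_coef0 : prev_coef M 0 = 0.
Proof. by rewrite /= ha0 expr0n mul0r. Qed.

Lemma prev_coefS (s : nat) :
  prev_coef M s.+1
  = a s.+1 ^+ 2 * ((jacobiP a b s).[eta] / (jacobiP a b s.+2).[eta]).
Proof. by rewrite /= jacobiP_predS. Qed.

(* At s = 0 the lower entry is 0, not a value of P_(-1) / P_(-1)(eta). *)
Lemma companion_prod_head (s : nat) (y : R) : (s <= N)%N ->
  companion_prod M 0 s (spectral_param mu L y) 0 0
    = (jacobiP a b s).[y] / (jacobiP a b s).[eta]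
  /\ ((0 < s)%N -> companion_prod M 0 s (spectral_param mu L y) 1 0
    = (jacobiP a b s.-1).[y] / (jacobiP a b s.-1).[eta]).
Proof.
elim: s => [|s IHs] lt_sN.
  by rewrite companion_prod_nil !mxE /jacobiP /= !hornerC divr1.
have [IH0 IH1] := IHs (ltnW lt_sN).
rewrite companion_prodSr // !mulmx2E !companion_lower mul1r mul0r addr0 IH0.
split=> //; rewrite companion_corner // companion_upper (horner_jacobiPS _ _ _ y).
have p0 := gt_eqF (hP lt_sN); have q0 := gt_eqF (hP (ltnW lt_sN)).
(* The lower entry is known only for positive indices; at index 0 its coefficient vanishes because
   [a 0 = 0]. *)
case: s => [|s] in lt_sN IHs IH0 IH1 p0 q0 *.
  rewrite prev_coef0 ha0 expr0n mul0r subr0 oppr0 mul0r addr0.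
  by field; rewrite p0 q0.
rewrite IH1 // prev_coefS jacobiP_predS /=.
have r0 := gt_eqF (hP (ltnW (ltnW lt_sN))).
by field; rewrite p0 q0 r0.
Qed.

(* For m = N the second entry is 0 while [jacobiQ N a b N.+1] is a junk value,
   hence the restriction to m < N. *)
Lemma companion_prod_tail (m : nat) (x : R) : (m < N)%N ->
  companion_prod M m N (spectral_param mu L x) 0 0
    = (jacobiP a b m).[eta] / (jacobiP a b N).[eta] * (jacobiQ N a b m).[x]
  /\ companion_prod M m N (spectral_param mu L x) 0 1
    = - (a m ^+ 2 * ((jacobiP_pred a b m).[eta] / (jacobiP a b N).[eta]))
      * (jacobiQ N a b m.+1).[x].
Proof.
(* Descending induction on [m]: [k] counts the factors beyond the first, and the base case is the
   single matrix of index [N - 1]. *)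
move=> lt_mN; have [k kN] : exists k, N = (m + k).+1.
  by exists (N - m.+1)%N; rewrite -addSn subnKC.
elim: k m kN lt_mN => [|k IHk] m kN lt_mN.
  have {kN}Nm : N = m.+1 by rewrite kN addn0.
  rewrite companion_prodSl // -Nm companion_prod_nil mul1mx.
  rewrite companion_corner // -Nm jacobiQ_full hornerC mulr1.
  rewrite [in jacobiQ _ _ _ _]Nm jacobiQ_last hornerXsubC; split=> //.
  by rewrite companion_upper /= -Nm.
have lt_m1N : (m.+1 < N)%N by rewrite kN addnS !ltnS leq_addr.
have [||IH0 IH1] := IHk m.+1; rewrite ?addSnnS //.
rewrite companion_prodSl // !mulmx2E !companion_lower companion_upper.
rewrite companion_corner // IH0 IH1 jacobiP_predS (jacobiQ_rec _ _ lt_m1N).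
have p0 := gt_eqF (hP lt_mN); have q0 := gt_eqF (hP (leqnn N)).
rewrite hornerD hornerN !hornerM !hornerE /=.
by split; field; rewrite p0 q0.
Qed.

Lemma variation_kernel_jacobi (s : nat) (x y : R) : (s < N)%N ->
  variation_kernel N M s (spectral_param mu L x) (spectral_param mu L y)
  = - (2 / (gap mu L * (jacobiP a b N).[eta]))
    * (jacobiQ N a b s.+1).[x] * (jacobiP a b s).[y].
Proof.
move=> lt_sN; rewrite /variation_kernel !e1_corner.
rewrite (companion_prod_head y (ltnW lt_sN)).1.
have -> : companion_prod M s.+1 N (spectral_param mu L x) 0 0
    = (jacobiP a b s.+1).[eta] / (jacobiP a b N).[eta]
      * (jacobiQ N a b s.+1).[x].
  (* At the last index the product is empty, outside the range of [companion_prod_tail]; there Q is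
     1 and the quotient of P values is 1. *)
  move: lt_sN; rewrite leq_eqVlt => /orP[/eqP sN|lt_s1N].
    rewrite sN companion_prod_nil jacobiQ_full mxE hornerC mulr1 divff //.
    by rewrite gt_eqF // hP.
  by rewrite (companion_prod_tail x lt_s1N).1.
have p0 := gt_eqF (hP (ltnW lt_sN)); have q0 := gt_eqF (hP (leqnn N)).
have r0 := gt_eqF (hP lt_sN); have g0 := gap_neq0.
by rewrite /= -/eta; field; rewrite p0 q0 r0 g0.
Qed.

End JacobiKernel.

(** * Change of variables and the gain *)

Lemma spectral_param_bound (R : realType) (mu L x : R) :
  mu < L -> -1 <= x <= 1 -> mu <= spectral_param mu L x <= L.
Proof.
move=> hL /andP[x1 x2]; rewrite /spectral_param /gap.
by apply/andP; split; nra.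
Qed.

Lemma spectral_param_onto (R : realType) (mu L l : R) : mu < L ->
  mu <= l <= L -> exists2 x, -1 <= x <= 1 & spectral_param mu L x = l.
Proof.
move=> hL /andP[l1 l2]; have g0 : 0 < L - mu by rewrite subr_gt0.
(* The witness is the inverse of the affine map [spectral_param]. *)
exists ((L + mu - 2 * l) / (L - mu)).
  by rewrite ler_pdivlMr // ler_pdivrMr //; apply/andP; split; lra.
by rewrite /spectral_param /gap; field; rewrite gt_eqF.
Qed.

Theorem theorem4p2 (R : realType) (mu L : R) (N : nat) (a b : nat -> R)
    (hmu : 0 < mu) (hL : mu < L) (hN : (1 <= N)%N)
    (ha0 : a 0%N = 0)
    (ha : forall s : nat, (1 <= s < N)%N -> 0 < a s)
    (hP : forall s : nat, (s <= N)%N -> 0 < (jacobiP a b s).[eta_param mu L]) :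
  (forall (s : nat) (x y : R), (s < N)%N -> -1 <= x <= 1 -> -1 <= y <= 1 ->
     variation_kernel N (jacobi_realization mu L a b) s
       (spectral_param mu L x) (spectral_param mu L y)
     = - (2 / (gap mu L * (jacobiP a b N).[eta_param mu L]))
       * (jacobiQ N a b s.+1).[x] * (jacobiP a b s).[y])
  /\
  gain mu L N (jacobi_realization mu L a b)
  = 2 / (gap mu L * `|(jacobiP a b N).[eta_param mu L]|)
    * sup [set t | exists x y : R, [/\ -1 <= x <= 1, -1 <= y <= 1 &
        t = Num.sqrt (\sum_(s < N)
              `|(jacobiQ N a b s.+1).[x] * (jacobiP a b s).[y]| ^+ 2)]]%classic.
Proof.
have kerE := variation_kernel_jacobi hL ha0 hP.
split=> [s x y lt_sN _ _|]; first exact: kerE.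
have g0 : 0 < gap mu L by rewrite subr_gt0.
(* Positivity of P at [eta] removes the absolute value, so [c] becomes the constant in the kernel
   formula up to sign. *)
have p0 := hP N (leqnn N); rewrite (gtr0_norm p0).
set c := 2 / _; have c0 : 0 < c by rewrite divr_gt0 // mulr_gt0.
have normE x y : Num.sqrt (\sum_(s < N) `|variation_kernel N
      (jacobi_realization mu L a b) s
      (spectral_param mu L x) (spectral_param mu L y)| ^+ 2)
    = c * Num.sqrt (\sum_(s < N)
        `|(jacobiQ N a b s.+1).[x] * (jacobiP a b s).[y]| ^+ 2).
  under eq_bigr => s _.
    rewrite kerE // -/c -mulrA normrM normrN (gtr0_norm c0) exprMn; over.
  by rewrite -mulr_sumr sqrtrM ?sqr_ge0 // sqrtr_sqr gtr0_norm.
(* With [c] moved inside the supremum, the two sets of values coincide, as [spectral_param] maps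
   [-1,1] onto [mu,L]. *)
rewrite /gain -sup_pscale //; congr sup; apply/seteqP; split=> t /=.
  case=> l [nu [/(spectral_param_onto hL)[x hx <-]]].
  case/(spectral_param_onto hL)=> y hy <- ->; rewrite normE.
  by eexists; [exists x, y; split | ].
case=> _ [x [y [hx hy ->]]] <-; rewrite -normE.
exists (spectral_param mu L x), (spectral_param mu L y).
by split=> //; exact: spectral_param_bound.
Qed.
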